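(* For every integer $n \ge 5$, the pegging number of the cycle $C_n$ is $P(C_n)=n-2$.
   Context: $C_n$ is the cycle on $n$ vertices. A distribution of pegs on a graph $G$ is a subset $D \subseteq V(G)$. If $u,v \in D$ are distinct adjacent vertices and $w \notin D$ is a vertex adjacent to $v$, the pegging move (jumping $u$ over $v$ into $w$) replaces $D$ by $(D\setminus\{u,v\})\cup\{w\}$. A vertex $t$ is reachable from $D$ if some finite (possibly empty) sequence of pegging moves starting from $D$ ends in a distribution containing $t$; $\mathrm{Reach}(D)$ is the set of reachable vertices. The pegging number $P(G)$ is the smallest positive integer $d$ such that every distribution of size $d$ on $G$ has reach $V(G)$. *)

(* Defs.v *)
From mathcomp Require Import all_boot.

Set Implicit Arguments.
Unset Strict Implicit.
Unset Printing Implicit Defensive.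

(* A finite graph is given by its adjacency relation e on a finType T, and a
   distribution of pegs is a set of vertices. *)

Section Pegging.

Variables (T : finType) (e : rel T).

Definition peg_move : rel {set T} := fun D D' =>
  [exists u in D, exists v in D, exists w,
     [&& u != v, e u v, w \notin D, e v w
       & D' == w |: (D :\: [set u; v])]].

(* connect is the reflexive transitive closure, i.e. finite, possibly empty,
   sequences of moves. *)
Definition peg_reach (D : {set T}) : {set T} :=
  [set t | [exists D' : {set T}, connect peg_move D D' && (t \in D')]].

Definition peg_sufficient (d : nat) : bool :=
  [forall D : {set T}, (#|D| == d) ==> (peg_reach D == [set: T])].

(* Witness for the minimum below: d = #|T| + 1 is vacuously sufficient, and
   positive even when T is empty; for nonempty T the minimum is at most #|T|. *)
Lemma ex_peg_sufficient : exists d, (0 < d) && peg_sufficient d.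
Proof.
exists #|T|.+1; rewrite /=; apply/forallP => D; apply/implyP => /eqP cD.
by have := max_card D; rewrite cD ltnn.
Qed.

Definition pegging_number : nat := ex_minn ex_peg_sufficient.

End Pegging.

(* ordS i is i + 1 modulo n; this is the simple graph C_n for n >= 3. *)
Definition cycle_graph (n : nat) : rel 'I_n :=
  fun i j => (j == ordS i) || (i == ordS j).

(* Main.v *)
Require Import Defs.
From mathcomp Require Import all_boot.
From mathcomp Require Import zify.

(** Upper bound: if two vertices are empty, one of them being [t], the other one
    cannot spoil both pairs [t+1, t+2] and [t-1, t-2], so a single jump fills [t].
    Lower bound: on the pegs contained in [2 .. n-2], the two Fibonacci weights
    [i |-> fib i] and [i |-> fib (n - i)] sum to less than [fib n].  No move that
    avoids [0] increases them, while a first jump into [0] has to consume either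
    the pegs [n-2, n-1] or the pegs [2, 1], one of whose weights is [fib n]. *)

Section Pegging.

Variables (T : finType) (e : rel T).
Implicit Types D : {set T}.

Lemma peg_moveP D D' :
  reflect (exists u v w, [/\ [/\ u \in D, v \in D, w \notin D & u != v], e u v, e v w
                           & D' = w |: (D :\: [set u; v])])
          (peg_move e D D').
Proof.
apply: (iffP idP) => [/existsP[u /andP[uD /existsP[v /andP[vD /existsP[w]]]]]|].
  by case/and5P=> uv euv wD evw /eqP->; exists u, v, w.
case=> u [v [w [[uD vD wD uv] euv evw ->]]].
apply/existsP; exists u; rewrite uD; apply/existsP; exists v; rewrite vD.
by apply/existsP; exists w; rewrite uv euv wD evw eqxx.
Qed.

Lemma peg_reachP D t :
  reflect (exists2 D', connect (peg_move e) D D' & t \in D') (t \in peg_reach e D).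
Proof.
rewrite inE; apply: (iffP existsP) => [[D' /andP[]]|[D' cD tD]]; first by exists D'.
by exists D'; rewrite cD.
Qed.

Lemma mem_peg_reach D t : t \in D -> t \in peg_reach e D.
Proof. by move=> tD; apply/peg_reachP; exists D. Qed.

Lemma jump_peg_reach D u v t :
  u \in D -> v \in D -> u != v -> e u v -> e v t -> t \in peg_reach e D.
Proof.
move=> uD vD uv euv evt.
have [tD|tD] := boolP (t \in D); first exact: mem_peg_reach.
apply/peg_reachP; exists (t |: (D :\: [set u; v])); last by rewrite setU11.
by apply/connect1/peg_moveP; exists u, v, t.
Qed.

(** Used contrapositively: an invariant [P] that no distribution containing [t] satisfies makes [t]
    unreachable. *)
Lemma peg_reach_invariant (P : pred {set T}) D t :
  (forall D1 D2, P D1 -> peg_move e D1 D2 -> P D2) ->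
  P D -> t \in peg_reach e D -> exists2 D', P D' & t \in D'.
Proof.
move=> PP PD /peg_reachP[D' /connectP[p pp ->] tD]; exists (last D p) => //.
by elim: p D PD pp {tD} => //= D1 p IHp D PD /andP[m]; apply/IHp/(PP D).
Qed.

(** The pegs of [D] other than [u] and [v] cancel, which leaves only [f w] against [f u + f v]. *)
Lemma leq_sum_peg_move (f : T -> nat) D u v w :
  u \in D -> v \in D -> u != v -> w \notin D -> f w <= f u + f v ->
  \sum_(i in w |: (D :\: [set u; v])) f i <= \sum_(i in D) f i.
Proof.
move=> uD vD uv wD fw; rewrite big_setU1 /=; last by rewrite !inE (negPf wD) andbF.
rewrite [leqRHS](big_setID [set u; v]) /=.
have /setIidPr-> : [set u; v] \subset D by rewrite subUset !sub1set uD vD.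
by rewrite big_setU1 ?inE // big_set1 leq_add2r.
Qed.

Lemma leq_sum_pair (f : T -> nat) D u v :
  u \in D -> v \in D -> u != v -> f u + f v <= \sum_(i in D) f i.
Proof.
move=> uD vD uv; rewrite (bigD1 u) //= (bigD1 v) /= ?vD 1?eq_sym //.
by rewrite addnA leq_addr.
Qed.

Lemma pegging_numberP d :
  0 < d -> peg_sufficient e d ->
  (forall d', 0 < d' < d -> ~~ peg_sufficient e d') -> pegging_number e = d.
Proof.
move=> d0 sd min_d; rewrite /pegging_number; case: ex_minnP => m /andP[m0 sm] le_m.
have : m <= d by rewrite le_m ?d0.
by rewrite leq_eqVlt => /orP[/eqP//|lt_md]; have := min_d m; rewrite m0 lt_md sm => /(_ isT).
Qed.

End Pegging.

Fixpoint fib (n : nat) : nat :=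
  if n is m.+1 then (if m is k.+1 then fib m + fib k else 1) else 0.

Lemma fibSS n : fib n.+2 = fib n.+1 + fib n. Proof. by []. Qed.

(** With the indices tied by equations, the recurrence also applies to arguments such as [n - u]. *)
Lemma fib_eqD a b c : b = a.+1 -> c = b.+1 -> fib c = fib a + fib b.
Proof. by move=> -> ->; rewrite fibSS addnC. Qed.

Lemma fib_gt0 n : 0 < n -> 0 < fib n.
Proof. by elim: n => // -[|n] // IHn _; rewrite fibSS ltn_addr ?IHn. Qed.

Lemma leq_fibS n : fib n <= fib n.+1.
Proof. by case: n => // n; rewrite fibSS leq_addr. Qed.

Lemma leq_fib m n : m <= n -> fib m <= fib n.
Proof. exact: (homo_leq leqnn leq_trans leq_fibS). Qed.

Lemma sum_fib d : \sum_(2 <= i < d.+2) fib i + 2 = fib d.+3.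
Proof.
elim: d => [|d IHd]; first by rewrite big_geq.
by rewrite big_nat_recr //= addnAC IHd.
Qed.

(** The sum telescopes, because [fib (n - i)] is [fib (n - i + 2)] minus [fib (n - i + 1)]. *)
Lemma sum_fib_rev n d :
  d < n -> \sum_(2 <= i < d.+2) fib (n - i) + fib (n - d) = fib n.
Proof.
elim: d => [|d IHd] dn; first by rewrite big_geq // subn0.
rewrite big_nat_recr //= -addnA -[RHS]IHd 1?ltnW //; congr (_ + _).
by apply/esym/fib_eqD; lia.
Qed.

Section Cycle.

Variable n : nat.
Hypothesis hn : 5 <= n.
Implicit Types (i j : 'I_n) (D : {set 'I_n}).
Local Notation C := (@cycle_graph n).

Lemma val_ordS i : ordS i = (if i.+1 == n then 0 else i.+1) :> nat.
Proof.
rewrite /=; have := ltn_ord i; case: eqP => [->|ne lt_in]; first by rewrite modnn.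
by rewrite modn_small //; lia.
Qed.

Lemma ordS_neq i : ordS i != i.
Proof.
apply/eqP => /(congr1 (@nat_of_ord n)); rewrite val_ordS; case: eqP; lia.
Qed.

Lemma val_ord_pred i : ord_pred i = (if i == 0 :> nat then n.-1 else i.-1) :> nat.
Proof.
rewrite /=; have lt_in := ltn_ord i; case: eqP => [->|ne].
  by rewrite modn_small //; lia.
by rewrite (_ : (i + n).-1 = i.-1 + n) ?modnDr ?modn_small //; lia.
Qed.

(** The last two cases isolate the edge between [n - 1] and [0], so that the rest is plain
    arithmetic. *)
Lemma cycle_graphP i j :
  C i j -> [\/ i.+1 = j, j.+1 = i, i.+1 = n /\ j = 0 :> nat | j.+1 = n /\ i = 0 :> nat].
Proof.
case/orP=> /eqP/(congr1 val); rewrite [X in _ = X]val_ordS /=; case: eqP => E ->.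
- exact: Or43.
- exact: Or41.
- exact: Or44.
- exact: Or42.
Qed.

Lemma cycle_graphS i : C i (ordS i). Proof. by rewrite /cycle_graph eqxx. Qed.

Lemma cycle_graphSr i : C (ordS i) i. Proof. by rewrite /cycle_graph eqxx orbT. Qed.

Lemma peg_sufficient_cycle : peg_sufficient C (n - 2).
Proof.
apply/forallP => D; apply/implyP => /eqP cD; rewrite -subTset; apply/subsetP => t _.
have [tD|tD] := boolP (t \in D); first exact: mem_peg_reach.
have [/andP[aD bD]|] := boolP ((ordS t \in D) && (ordS (ordS t) \in D)).
  apply: (jump_peg_reach _ _ _ _ _ _ bD aD); try exact: cycle_graphSr.
  exact: ordS_neq.
have [/andP[aD bD]|] := boolP ((ord_pred t \in D) && (ord_pred (ord_pred t) \in D)).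
  move=> _; apply: (jump_peg_reach _ _ _ _ _ _ bD aD).
  - by rewrite eq_sym -{1}[ord_pred t]ord_predK; apply: ordS_neq.
  - by rewrite -{2}[ord_pred t]ord_predK; apply: cycle_graphS.
  - by rewrite -{2}[t]ord_predK; apply: cycle_graphS.
(* Each pair now has an empty vertex. As [n >= 5], these two vertices and [t] are distinct, whereas
   only two vertices are empty. *)
suff two_empty x y : x \notin D -> y \notin D ->
    ~ [/\ t <> x :> nat, t <> y :> nat & x <> y :> nat].
  have := val_ordS (ordS t); have := val_ord_pred (ord_pred t).
  have := val_ordS t; have := val_ord_pred t; have := ltn_ord t.
  rewrite !negb_and => lt_tn Pt St PPt SSt /orP[] yD /orP[] xD;
    case: (two_empty _ _ xD yD); split;
    move: Pt St PPt SSt; do ![case: eqP]; lia.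
move=> xD yD [tx ty xy].
have /card_uniqP c3 : uniq [:: t; x; y].
  by rewrite /= !inE negb_or -!val_eqE /= andbT; apply/andP; split; [apply/andP; split|]; apply/eqP.
have : #|[:: t; x; y]| <= #|~: D|.
  by apply/subset_leq_card/subsetP => z; rewrite !inE => /or3P[]/eqP->.
rewrite c3 cardsCs setCK cD card_ord /=; lia.
Qed.

Definition fib_light D :=
  [&& [forall i in D, 0 < i], \sum_(i in D) fib i < fib n
    & \sum_(i in D) fib (n - i) < fib n].

Lemma fib_light_move D D' : fib_light D -> peg_move C D D' -> fib_light D'.
Proof.
case/and3P=> /forall_inP D0 wD wD' /peg_moveP[u [v [w [[uD vD wND uv] euv evw ->]]]].
have u0 := D0 _ uD; have v0 := D0 _ vD; have lw := ltn_ord w.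
have lu := ltn_ord u; have lv := ltn_ord v.
(* Hence the jump goes straight on: [w] is the neighbour of [v] on the side away from [u]. *)
have neq_wu : w <> u :> nat by move=> /ord_inj E; rewrite E uD in wND.
have k1 := leq_sum_pair _ (fun i => fib i) _ _ _ uD vD uv.
have k2 := leq_sum_pair _ (fun i => fib (n - i)) _ _ _ uD vD uv.
have [w0 f1 f2] : [/\ 0 < w, fib w <= fib u + fib v
    & fib (n - w) <= fib (n - u) + fib (n - v)].
  (* Both [u] and [v] are nonzero, so the edge between them does not wrap around. In an upward jump
     the weight [fib] is kept exactly and the reversed one does not grow; a downward jump swaps
     these roles. *)
  have [Ev|Ev] : u.+1 = v \/ v.+1 = u by case: (cycle_graphP _ _ euv); lia.
    have [Ew|Ew] : v.+1 = w \/ v.+1 = n by case: (cycle_graphP _ _ evw); lia.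
      rewrite (fib_eqD u v w) // leqnn -Ew; split=> //.
      by apply: leq_trans (leq_addl _ _); apply: leq_fib; lia.
    (* Here [w] would be [0], with [u = n - 2] and [v = n - 1]: these two pegs alone weigh
       [fib n]. *)
    by move: (leq_ltn_trans k1 wD); rewrite (fib_eqD u v n) ?ltnn.
  have [w0|w0] := posnP w.
    (* Symmetrically, [u = 2] and [v = 1] have reversed weight [fib n]. *)
    move: (leq_ltn_trans k2 wD'); rewrite -(fib_eqD (n - u) (n - v) n) ?ltnn //;
      by case: (cycle_graphP _ _ evw); lia.
  have Ew : w.+1 = v by case: (cycle_graphP _ _ evw); lia.
  rewrite (fib_eqD (n - u) (n - v) (n - w)) ?leqnn; [|lia|lia].
  by split=> //; apply: leq_trans (leq_addr _ _); apply: leq_fib; lia.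
apply/and3P; split.
- by apply/forall_inP => i; rewrite !inE => /orP[/eqP->//|/andP[_ /D0]].
- exact: leq_ltn_trans (leq_sum_peg_move _ (fun i => fib i) _ _ _ _ uD vD uv wND f1) wD.
- exact: leq_ltn_trans (leq_sum_peg_move _ (fun i => fib (n - i)) _ _ _ _ uD vD uv wND f2) wD'.
Qed.

(** For [d <= n - 3] this block of pegs leaves [0] and both its neighbours empty. *)
Definition peg_segment (d : nat) : {set 'I_n} := [set i : 'I_n | 2 <= i < d.+2].

Lemma sum_peg_segment (f : nat -> nat) d :
  d.+2 <= n -> \sum_(i in peg_segment d) f i = \sum_(2 <= i < d.+2) f i.
Proof.
move=> dn; rewrite (big_nat_widen _ _ n) // (big_nat_widenl _ 0) // big_mkord.
by apply: eq_bigl => i; rewrite inE andbC.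
Qed.

Lemma card_peg_segment d : d.+2 <= n -> #|peg_segment d| = d.
Proof.
move=> dn; rewrite -sum1_card (sum_peg_segment (fun=> 1)) // sum_nat_const_nat.
by rewrite muln1 !subSS subn0.
Qed.

(** The weights are [fib (d + 3) - 2] and [fib n - fib (n - d)], both below [fib n]. *)
Lemma fib_light_segment d : d.+3 <= n -> fib_light (peg_segment d).
Proof.
move=> dn; have dn2 := ltnW dn; apply/and3P; split.
- by apply/forall_inP => i; rewrite inE => /andP[/ltnW].
- rewrite sum_peg_segment //; have := sum_fib d; have := leq_fib _ _ dn; lia.
- rewrite (sum_peg_segment (fun k => fib (n - k))) // -[ltnRHS](sum_fib_rev n d).
    by rewrite -[ltnLHS]addn0 ltn_add2l fib_gt0; lia.
  by lia.
Qed.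

Lemma peg_insufficient_cycle d : d.+3 <= n -> ~~ peg_sufficient C d.
Proof.
move=> dn; apply/negP => /forallP/(_ (peg_segment d)).
rewrite card_peg_segment ?(ltnW dn) // eqxx => /eqP full.
have n0 : 0 < n by lia.
have : Ordinal n0 \in peg_reach C (peg_segment d) by rewrite full inE.
case/(peg_reach_invariant _ _ _ _ _ fib_light_move (fib_light_segment d dn)) => D.
by case/and3P=> /forall_inP D0 _ _ /D0.
Qed.

End Cycle.

Theorem theorem3p1 (n : nat) (hn : 5 <= n) :
  pegging_number (@cycle_graph n) = n - 2.
Proof.
apply: pegging_numberP; [lia | exact: peg_sufficient_cycle |].
by move=> d /andP[_ dn]; apply: peg_insufficient_cycle; lia.
Qed.
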